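(* Let $G$ be a finite group. The left regular representation of $G$ can be generated (for $\oplus$ and $\otimes$) by $cl(G)$ irreducible complex representations, where $cl(G)$ is the cyclic length of $G$.
   Context: For finite groups $H\subseteq K$, $[H,K]$ denotes the lattice of subgroups $L$ with $H\subseteq L\subseteq K$. The inclusion $(H\subseteq K)$ is called cyclic if $[H,K]$ is a distributive lattice and every $L\in[H,K]$ is normal-intermediate, i.e. $HgL=LgH$ for all $g\in K$. The cyclic length $cl(G)$ is the minimal length $n$ of an ordered chain of subgroups $\{1\}=H_0\subset H_1\subset\dots\subset H_n=G$ such that every inclusion $(H_i\subseteq H_{i+1})$ is cyclic. Representations $V_1,\dots,V_m$ of $G$ generate the left regular representation if it appears as a direct component of some representation obtained from $V_1,\dots,V_m$ by (repeated) direct sums and tensor products. *)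

(* Defs.v *)
(* Mathematical Components; complex numbers are R[i] with R : realType. *)
From HB Require Import structures.
From mathcomp Require Export all_boot all_order all_algebra all_fingroup.
From mathcomp Require Export all_solvable all_character.
From mathcomp Require Export reals.
From mathcomp Require Export complex.

Set Implicit Arguments.
Unset Strict Implicit.
Unset Printing Implicit Defensive.

Import GroupScope GRing.Theory.
Local Open Scope group_scope.

Section CyclicLength.

Variable gT : finGroupType.
Implicit Types G H K L M : {group gT}.

Definition intermediate H K L := (H \subset L) && (L \subset K).

(* In the lattice of subgroups the meet is :&: and the join is <*>. *)
Definition distributive_interval H K :=
  [forall A : {group gT}, forall B : {group gT}, forall C : {group gT},
    [&& intermediate H K A, intermediate H K B & intermediate H K C] ==>
    (A :&: (B <*> C) == (A :&: B) <*> (A :&: C))].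

Definition normal_intermediate H K L := [forall g in K, H :* g * L == L :* g * H].

Definition cyclic_inclusion H K :=
  [&& H \subset K, distributive_interval H K
    & [forall L : {group gT}, intermediate H K L ==> normal_intermediate H K L]].

Definition cyclic_step : rel {group gT} :=
  fun H K => (H \proper K) && cyclic_inclusion H K.

(* The tuple lists H_1, ..., H_n; the chain starts at H_0 = 1. *)
Definition has_cyclic_chain G n :=
  [exists s : n.-tuple {group gT}, path cyclic_step 1%G s && (last 1%G s == G)].

Lemma cyclic_step_maximal G M : maximal M G -> cyclic_step M G.
Proof.
move=> maxM; have prM := maxgroupp maxM; rewrite /cyclic_step prM /=.
have sMG := proper_sub prM.
have two L : intermediate M G L -> L = M \/ L = G.
  case/andP=> sML sLG; have [eqLG|ltLG] := eqVproper sLG; [right|left].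
    exact/val_inj.
  by apply/val_inj; case/maxgroupP: maxM => _ /(_ L ltLG sML).
apply/and3P; split=> //; last first.
  apply/forallP=> L; apply/implyP=> /two[]->; apply/forall_inP=> g Gg //.
  by rewrite (rcoset_id Gg) (mulGSid sMG) -mulgA lcoset_id // mulSGid.
apply/forallP=> A; apply/forallP=> B; apply/forallP=> C; apply/implyP.
have joinMG : M <*> G = G by apply/joing_idPr.
have joinGM : G <*> M = G by apply/joing_idPl.
have joinid (H : {group gT}) : H <*> H = H by apply/joing_idPl.
by case/and3P=> /two[]-> /two[]-> /two[]->; apply/eqP;
  rewrite !(joinMG, joinGM, joinid, setIid, setIidPl sMG, setIidPr sMG).
Qed.

Lemma has_cyclic_chain_ex G : exists n, has_cyclic_chain G n.
Proof.
have [m] := ubnP #|G|; elim: m G => // m IHm G ltGm.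
have [G1|ntG] := eqVneq G 1%G.
  by exists 0; apply/existsP; exists [tuple]; rewrite /= G1.
have [eq1G|[M maxM _]] := maximal_exists (sub1G G).
  by case/eqP: ntG; apply/val_inj.
have [|n /existsP[s /andP[chain_s /eqP last_s]]] := IHm M.
  by rewrite (leq_trans (proper_card (maxgroupp maxM))).
exists n.+1; apply/existsP; exists [tuple of rcons s G].
by rewrite /= rcons_path last_rcons eqxx chain_s last_s cyclic_step_maximal.
Qed.

Definition cyclic_length G : nat := ex_minn (has_cyclic_chain_ex G).

End CyclicLength.

Local Open Scope ring_scope.

Section Generation.

Variables (F : fieldType) (gT : finGroupType) (G : {group gT}).
Implicit Types U W : representation F G.

Definition tensor_grepr U W : representation F G :=
  Representation (prod_repr U W).

Fact triv_mx_repr : mx_repr G (fun _ : gT => 1%:M : 'M[F]_1).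
Proof. by split=> // x y _ _; rewrite mulmx1. Qed.

Definition triv_grepr : representation F G :=
  Representation (MxRepresentation triv_mx_repr).

(* In the basis of group elements, x sends the column vector e_h to e_(x h).  *)
(* The library's regular_repr is instead the right translation e_h -> e_(h x) *)
(* of row vectors.                                                            *)
Definition left_regular_mx (x : gT) : 'M[F]_#|G| :=
  \matrix_(i, j) (enum_val i == (x * enum_val j)%g)%:R.

Fact left_regular_mx_repr : mx_repr G left_regular_mx.
Proof.
split=> [|x y Gx Gy]; apply/matrixP=> i j; rewrite !mxE.
  by rewrite mul1g (inj_eq enum_val_inj).
have Gyj : (y * enum_val j)%g \in G by rewrite groupM ?enum_valP.
rewrite (bigD1 (enum_rank_in (group1 G) (y * enum_val j)%g)) //= !mxE.
rewrite enum_rankK_in // eqxx mulr1 mulgA big1 ?addr0 // => k ne_k.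
rewrite !mxE; case: eqP => [_|_]; last by rewrite mul0r.
case: eqP => [def_k|_]; last by rewrite mulr0.
by case/eqP: ne_k; rewrite -def_k enum_valK_in.
Qed.

Definition left_regular_grepr : representation F G :=
  Representation (MxRepresentation left_regular_mx_repr).

Lemma left_regular_rsim : mx_rsim left_regular_grepr (regular_repr F G).
Proof.
pose inv_ord (i : 'I_#|G|) := enum_rank_in (group1 G) (enum_val i)^-1%g.
have inv_ordE i : enum_val (inv_ord i) = (enum_val i)^-1%g.
  by rewrite enum_rankK_in // groupV enum_valP.
have inv_ordK : involutive inv_ord.
  by move=> i; apply: enum_val_inj; rewrite !inv_ordE invgK.
exists (perm_mx (perm (inv_inj inv_ordK))) => //.
  by rewrite row_free_unit unitmx_perm.
move=> x Gx; set s := perm _.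
have sV : s^-1%g = s.
  apply: (mulgI s); rewrite mulgV; apply/permP=> i.
  by rewrite permM !permE /= inv_ordK.
rewrite -{1}sV -col_permE -row_permE; apply/matrixP=> i j.
rewrite !mxE !permE /= inv_ordE; congr (nat_of_bool _)%:R.
have Gix : ((enum_val i)^-1 * x)%g \in G by rewrite groupM ?groupV ?enum_valP.
rewrite inv_ordE -(inj_eq enum_val_inj) enum_rankK_in //.
apply/eqP/eqP=> [->|->]; first by rewrite invMg invgK mulgKV.
by rewrite invMg invgK mulKVg.
Qed.

(* The complement may be zero: representations of degree 0 are allowed. *)
Definition direct_component U W :=
  exists U' : representation F G, mx_rsim W (dadd_grepr U U').

(* The unit for tensor is added only when the family is empty, as its empty   *)
(* tensor product: the trivial group has cyclic length 0 and its regular      *)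
(* representation is the trivial one.                                         *)
Inductive generated m (V : 'I_m -> representation F G) :
    representation F G -> Prop :=
| Generated_base i : generated V (V i)
| Generated_sum U W :
    generated V U -> generated V W -> generated V (dadd_grepr U W)
| Generated_tensor U W :
    generated V U -> generated V W -> generated V (tensor_grepr U W)
| Generated_empty : m = 0 -> generated V triv_grepr.

Definition generates_left_regular m (V : 'I_m -> representation F G) :=
  exists2 W, generated V W & direct_component left_regular_grepr W.

End Generation.

(* Main.v *)
Require Import Defs.
From mathcomp Require Import boolp.

Set Implicit Arguments.
Unset Strict Implicit.
Unset Printing Implicit Defensive.

(** The argument has two independent halves.

    The first half produces, for every step H < K of a cyclic chain of G, an
    irreducible representation V of G whose kernel meets K inside H
    (cyclic_inclusion_irr). For L <= G let P_L be the average of L, acting on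
    some representation of G. If the kernel of V contains an element of K
    outside H, then together with H it generates a subgroup containing an atom
    A of [H, K], and P_A = P_H on V. So it is enough to find an irreducible V
    not killed by the product of the factors P_H - P_A over all atoms A. By
    complete reducibility, such a V exists once that product is nonzero on the
    left regular representation, where it is detected by a trace
    (trace_avoid_mx). Normal intermediacy makes intermediate subgroups permute,
    so that P_A P_B = P_(A <*> B). Distributivity shows that an atom still
    meets a join of other atoms in H only, so that the indices over H multiply.
    The trace is then the product of the positive numbers 1 - |H| / |A|, up to
    a nonzero factor.

    Going down a chain 1 = H_0 < ... < H_n = G, an element in the kernel of all
    n representations lies in H_n, then in H_(n-1), ..., and finally in H_0 = 1
    (cyclic_chain_irr): their kernels intersect trivially.

    The second half is a variant of the Burnside-Brauer theorem
    (faithful_family_generates). The functions x |-> u W(x) v on G, for W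
    generated by the family, u a row and v a column, are closed under linear
    combinations, because of direct sums, and under products, because of tensor
    products. If the kernels intersect trivially these functions separate 1
    from the other elements, and interpolation shows that the indicator
    function of 1 is one of them. The translates u W(x) are then linearly
    independent and span a copy of the regular representation inside W, which
    has a complement by Maschke's theorem. *)

Import GroupScope GRing.Theory.
Local Open Scope ring_scope.

(** * Averaging operators over subgroups *)

Lemma natr_card_neq0 (F : fieldType) (gT : finGroupType) (L : {group gT}) :
  [pchar F] =i pred0 -> #|L|%:R != 0 :> F.
Proof. by move/pcharf0P->; rewrite -lt0n cardG_gt0. Qed.

Lemma pchar0_pgroup (F : fieldType) (gT : finGroupType) (G : {group gT}) :
  [pchar F] =i pred0 -> [pchar F]^'.-group G.
Proof. by move=> charF0; apply/pgroupP=> p _ _; rewrite inE /= charF0. Qed.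

Section Average.

Variables (F : fieldType) (gT : finGroupType) (G : {group gT}).
Variables (n : nat) (rG : mx_representation F G n).
Hypothesis charF0 : [pchar F] =i pred0.
Implicit Types A B L : {group gT}.

Definition avg_mx (L : {set gT}) : 'M[F]_n :=
  #|L|%:R^-1 *: \sum_(x in L) rG x.

Let card_neq0 L : #|L|%:R != 0 :> F.
Proof. exact: natr_card_neq0. Qed.

Lemma avg_mx_mulr L x : L \subset G -> x \in L -> avg_mx L *m rG x = avg_mx L.
Proof.
move=> sLG Lx; have Gx := subsetP sLG x Lx.
rewrite -scalemxAl mulmx_suml; congr (_ *: _).
rewrite [RHS](reindex_inj (mulIg x)) /=; apply: eq_big => y.
  by rewrite groupMr.
by move=> Ly; rewrite repr_mxM ?(subsetP sLG).
Qed.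

Lemma mul_avg_mx_fixed m (U : 'M[F]_(m, n)) L :
  (forall x, x \in L -> U *m rG x = U) -> U *m avg_mx L = U.
Proof.
move=> fixU; rewrite -scalemxAr mulmx_sumr (eq_bigr (fun _ => U)) //.
by rewrite sumr_const -scaler_nat scalerA mulVf ?scale1r.
Qed.

(** Each element of the set A * B is a product of an element of A and an
    element of B in exactly #|A :&: B| ways, and when A and B permute this set
    is the subgroup that they generate. *)
Lemma avg_mx_mul A B : A \subset G -> B \subset G -> commute A B ->
  avg_mx A *m avg_mx B = avg_mx (A <*> B).
Proof.
move=> sAG sBG cAB; rewrite comm_joingE //.
rewrite /avg_mx -scalemxAl -scalemxAr scalerA mulmx_suml.
have ->: \sum_(a in A) rG a *m (\sum_(b in B) rG b)
       = #|A :&: B|%:R *: \sum_(x in (A * B)%g) rG x.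
  transitivity (\sum_(a in A) \sum_(x in (a *: B)%g) rG x).
    apply: eq_bigr => a Aa; rewrite mulmx_sumr.
    rewrite [RHS](reindex_inj (mulgI a)) /=; apply: eq_big => b.
      by rewrite mem_lcoset mulKg.
    by move=> Bb; rewrite repr_mxM ?(subsetP sAG a) ?(subsetP sBG b).
  rewrite (exchange_big_dep (mem (A * B)%g)) /=; last first.
    by move=> a x Aa /lcosetP[b Bb ->]; rewrite mem_mulg.
  rewrite scaler_sumr; apply: eq_bigr => _ /mulsgP[a b Aa Bb ->].
  rewrite sumr_const -scaler_nat; congr (_%:R *: _).
  rewrite -(card_lcoset (A :&: B) a); apply: eq_card => c.
  rewrite -[LHS]/((c \in A) && ((a * b)%g \in (c *: B)%g)) !mem_lcoset inE.
  rewrite (@groupMl _ A) ?groupV //; congr (_ && _).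
  by rewrite mulgA groupMr // -groupV invMg invgK.
rewrite scalerA; congr (_ *: _).
have AB_neq0: #|(A * B)%g|%:R != 0 :> F by rewrite -comm_joingE ?card_neq0.
have: #|A|%:R * #|B|%:R = #|(A * B)%g|%:R * #|A :&: B|%:R :> F.
  by rewrite -!natrM mul_cardG.
by rewrite -invfM => ->; rewrite invfM -mulrA mulVf ?mulr1.
Qed.

End Average.

(** * The complement of the atoms of an interval *)

Section AtomComplement.

Variables (F : fieldType) (gT : finGroupType) (G : {group gT}).
Hypothesis charF0 : [pchar F] =i pred0.
Implicit Types A B H K L : {group gT}.

Let card_neq0 L : #|L|%:R != 0 :> F.
Proof. exact: natr_card_neq0. Qed.

(** When the subgroups in s contain H and permute, this acts on the H-fixed
    vectors as a projection that kills those fixed by some member of s. *)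
Definition avoid_mx n (rG : mx_representation F G n) H (s : seq {group gT}) :=
  foldr (fun A E => E *m (avg_mx rG H - avg_mx rG A)) 1%:M s.

Lemma avoid_mx_module n (rG : mx_representation F G n) (U : 'M_n) H s :
    mxmodule rG U -> H \subset G -> all (fun A : {group gT} => A \subset G) s ->
  (U *m avoid_mx rG H s <= U)%MS.
Proof.
move=> modU sHG; have avgU A : A \subset G -> (U *m avg_mx rG A <= U)%MS.
  move=> sAG; rewrite -scalemxAr scalemx_sub // mulmx_sumr summx_sub // => x Ax.
  by rewrite (mxmoduleP modU) ?(subsetP sAG).
elim: s => [|A s IHs] /=; first by rewrite mulmx1.
case/andP=> sAG sG; rewrite mulmxA (submx_trans (submxMr _ (IHs sG))) //.
by rewrite mulmxBr addmx_sub ?eqmx_opp ?avgU.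
Qed.

(** The factors applied before that of A preserve U, and the factor of A
    vanishes on U. *)
Lemma avoid_mx_eq0 n (rG : mx_representation F G n) (U : 'M_n) H s A :
    mxmodule rG U -> H \subset G -> all (fun A : {group gT} => A \subset G) s ->
    A \in s -> U *m avg_mx rG H = U *m avg_mx rG A ->
  U *m avoid_mx rG H s = 0.
Proof.
move=> modU sHG; elim: s => //= B s IHs /andP[sBG sG]; rewrite inE.
case/predU1P=> [<-|sA] eqHA; last by rewrite mulmxA IHs ?mul0mx.
have /submxP[D defU]:= avoid_mx_module modU sHG sG.
by rewrite mulmxA defU -mulmxA mulmxBr eqHA subrr mulmx0.
Qed.

Let lG := MxRepresentation (left_regular_mx_repr F G).

Lemma trace_left_regular x :
  x \in G -> \tr (lG x) = (#|G| * (x == 1%g))%:R.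
Proof.
move=> Gx; rewrite /mxtrace (eq_bigr (fun _ => (x == 1%g)%:R)) => [|i _].
  by rewrite sumr_const card_ord natrM mulr_natl.
by rewrite mxE -{1}[enum_val i]mul1g (inj_eq (mulIg _)) eq_sym.
Qed.

Lemma trace_avg_left_regular L :
  L \subset G -> \tr (avg_mx lG L) = #|G|%:R / #|L|%:R.
Proof.
move=> sLG; rewrite linearZ /= raddf_sum /= (bigD1 1%g) //=.
rewrite trace_left_regular // eqxx muln1 big1 ?addr0 1?mulrC // => x.
case/andP=> Lx /negPf x1; rewrite trace_left_regular ?(subsetP sLG) //.
by rewrite x1 muln0.
Qed.

(** Expanding the factor of A turns the average over L into the difference of
    those over L and A <*> L. Distributivity lets the induction go on with
    A <*> L, since B :&: (A <*> L) is the join of B :&: A and B :&: L, both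
    equal to H, for the remaining B. The index is multiplicative because
    |A <*> L| |H| = |A| |L|. *)
Lemma trace_avoid_mx H K s L :
    K \subset G -> distributive_interval H K ->
    (forall A B, intermediate H K A -> intermediate H K B -> commute A B) ->
    all (intermediate H K) s -> uniq s ->
    {in s &, forall A B, A != B -> A :&: B = H} ->
    intermediate H K L -> {in s, forall A, A :&: L = H} ->
  \tr (avoid_mx lG H s *m avg_mx lG L)
    = #|G|%:R / #|L|%:R * \prod_(A <- s) (1 - #|H|%:R / #|A|%:R).
Proof.
move=> sKG distr comm; elim: s L => [|A s IHs] L /=.
  move=> _ _ _ /andP[sHL sLK] _; rewrite big_nil mulr1 mul1mx.
  by rewrite trace_avg_left_regular ?(subset_trans sLK).
case/andP=> inA ins /andP[sA Us] dis inL disL.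
have [[sHA sAK] [sHL sLK]] := (andP inA, andP inL).
have inH: intermediate H K H by rewrite /intermediate subxx (subset_trans sHL).
have [sAG sLG] := (subset_trans sAK sKG, subset_trans sLK sKG).
have sHG := subset_trans sHL sLG.
have disAL: A :&: L = H by rewrite disL ?mem_head.
rewrite -mulmxA mulmxBl !avg_mx_mul //; try exact: comm.
rewrite (joing_idPr sHL) mulmxBr raddfB /=.
have inAL: intermediate H K (A <*> L).
  by rewrite /intermediate join_subG sAK sLK (subset_trans sHA) ?joing_subl.
have dis': {in s &, forall B C, B != C -> B :&: C = H}.
  by move=> B C sB sC; apply: dis; rewrite inE ?sB ?sC orbT.
rewrite IHs //; last by move=> B sB; rewrite disL // inE sB orbT.
rewrite (IHs (A <*> L)%G) //; last first.
  move=> B sB; have inB := allP ins B sB.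
  have /forallP/(_ B)/forallP/(_ A)/forallP/(_ L)/implyP := distr.
  rewrite inB inA inL => /(_ isT)/eqP->; rewrite disL ?inE ?sB ?orbT //.
  rewrite dis ?mem_head ?inE ?sB ?orbT ?joingg //; first exact/joing_idPl.
  by apply: contraNneq sA => <-.
rewrite big_cons -mulrBl mulrA; congr (_ * _).
rewrite -mulrBr -[in RHS]mulrA; congr (_ * _).
have /(congr1 (fun k => k%:R : F)) := mul_cardG A L.
rewrite disAL !natrM -comm_joingE; last exact: comm.
move=> card_AL; rewrite mulrBr mulr1; congr (_ - _).
have ->: #|A <*> L|%:R = #|A|%:R * #|L|%:R / #|H|%:R :> F.
  by rewrite card_AL mulfK.
by rewrite !invfM invrK mulrC mulrA mulrC.
Qed.

(** The whole space is a sum of simple submodules. The decomposition is only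
    available under a double negation, hence the proof by contradiction. *)
Lemma simple_not_annihilated n (rG : mx_representation F G n) (M : 'M_n) :
  M != 0 -> exists2 U : 'M_n, mxsimple rG U & U *m M != 0.
Proof.
move=> nzM; apply: contrapT => noU.
have red1 := mx_Maschke_pchar rG (pchar0_pgroup G charF0).
have /negP[] : ~~ true; last by [].
apply: (mx_reducible_semisimple (mxmodule1 rG) red1) => -[I U /= simU defU _].
case/negP: nzM; apply/eqP; rewrite -[M]mul1mx; apply/sub_kermxP.
rewrite -defU; apply/sumsmx_subP=> i _; apply/sub_kermxP/eqP.
by apply/idPn=> nzUM; case: noU; exists (U i).
Qed.

(** Take the union of the equalities H b A = A b H over b in B, which absorbs
    H on either side. *)
Lemma normal_intermediate_commute H K A B :
    (forall L, intermediate H K L -> normal_intermediate H K L) ->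
  intermediate H K A -> intermediate H K B -> commute A B.
Proof.
move=> nor inA /andP[sHB sBK].
have /forall_inP norA := nor A inA.
have eqAB g : g \in B -> (H * [set g] * A = A * [set g] * H)%g.
  by move=> Bg; apply/eqP/norA/(subsetP sBK).
apply/eqP; rewrite eqEsubset; apply/andP; split.
  apply/subsetP=> _ /mulsgP[a b Aa Bb ->].
  have: (a * b)%g \in (A * [set b] * H)%g.
    by rewrite -[(a * b)%g]mulg1 mem_mulg // mem_mulg ?set11.
  rewrite -eqAB // => /mulsgP[_ c /mulsgP[h _ Hh /set1P-> ->] Ac ->].
  by rewrite mem_mulg // groupM // (subsetP sHB).
apply/subsetP=> _ /mulsgP[b a Bb Aa ->].
have: (b * a)%g \in (H * [set b] * A)%g.
  by rewrite mem_mulg // mem_rcoset mulgV group1.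
rewrite eqAB // => /mulsgP[_ h /mulsgP[c _ Ac /set1P-> ->] Hh ->].
by rewrite -mulgA mem_mulg // groupM // (subsetP sHB).
Qed.

(** The representation is found directly among the simple submodules of the
    regular representation of G, so that nothing has to be extended from K. *)
Lemma cyclic_inclusion_irr H K : K \subset G -> cyclic_inclusion H K ->
  exists V : representation F G, mx_irreducible V /\ rker V :&: K \subset H.
Proof.
move=> sKG /and3P[sHK distr /forallP nor].
have sHG := subset_trans sHK sKG.
have comm A B : intermediate H K A -> intermediate H K B -> commute A B.
  by apply: normal_intermediate_commute => L; apply/implyP.
pose over (A : {group gT}) := (H \proper A) && (A \subset K).
pose atoms := [seq A : {group gT} <- enum {group gT} | mingroup A over].
have atomP A : A \in atoms = mingroup A over.
  by rewrite mem_filter mem_enum andbT.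
have atom_in : all (intermediate H K) atoms.
  apply/allP=> A; rewrite atomP => /mingroupp/andP[/proper_sub sHA sAK].
  exact/andP.
have atom_dis : {in atoms &, forall A B, A != B -> A :&: B = H}.
  move=> A B; rewrite !atomP => minA minB; apply: contraNeq => neqH.
  have [/andP[prA sAK] mA] := mingroupP minA.
  have [/andP[prB sBK] mB] := mingroupP minB.
  have overAB: over (A :&: B)%G.
    rewrite /over subIset ?sAK // properEneq eq_sym neqH.
    by rewrite subsetI !proper_sub.
  apply/eqP; apply: val_inj.
  apply: etrans (esym (mA _ overAB (subsetIl _ _))) _.
  exact: mB _ overAB (subsetIr _ _).
have inH : intermediate H K H by rewrite /intermediate subxx.
have nzE : avoid_mx lG H atoms *m avg_mx lG H != 0.
  apply: contraTneq isT => E0.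
  have disH : {in atoms, forall A, A :&: H = H}.
    by move=> A /(allP atom_in)/andP[sHA _]; apply/setIidPr.
  have Us : uniq atoms by rewrite filter_uniq ?enum_uniq.
  have := trace_avoid_mx sKG distr comm atom_in Us atom_dis inH disH.
  rewrite E0 mxtrace0 => /esym/eqP; apply: contraLR => _.
  rewrite !mulf_neq0 ?invr_eq0 // prodf_seq_neq0.
  apply/allP=> A; rewrite atomP => /mingroupp/andP[prA _] /=.
  rewrite subr_eq0 eq_sym; apply: contraTneq (proper_card prA) => eqHA.
  rewrite -leqNgt -subn_eq0 -((pcharf0P F).1 charF0) natrB.
    by rewrite subr_eq0 eq_sym -[_%:R](divfK (card_neq0 A)) eqHA mul1r.
  by rewrite subset_leq_card ?proper_sub.
have [U simU nzUE] := simple_not_annihilated lG nzE.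
have [modU _ _] := simU.
exists (Representation (submod_repr modU)); split; first exact/submod_mx_irr.
rewrite rker_submod; apply/subsetP=> g /setIP[fixg Kg]; apply/idPn=> notHg.
pose L := (H <*> <[g]>)%G.
have overL : over L.
  rewrite /over join_subG sHK cycle_subG Kg properE joing_subl /= join_subG.
  by rewrite subxx cycle_subG andbT.
have [A minA sAL] := mingroup_exists overL.
have sA : A \in atoms by rewrite atomP.
have /andP[sHA sAK] := allP atom_in A sA.
have sAG := subset_trans sAK sKG.
(* Both H and g fix the H-averages of the vectors of U, hence so does A. *)
have fixL : L \subset rstab lG (U *m avg_mx lG H).
  rewrite join_subG cycle_subG; apply/andP; split.
    apply/subsetP=> h Hh; rewrite inE (subsetP sHG) //=.
    by rewrite -mulmxA avg_mx_mulr.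
  apply: subsetP fixg; apply: rstabS.
  rewrite -scalemxAr scalemx_sub // mulmx_sumr summx_sub // => x Hx.
  by rewrite (mxmoduleP modU) ?(subsetP sHG).
case/negP: nzUE; rewrite mulmxA (avoid_mx_eq0 modU sHG _ sA) ?mul0mx //.
  apply/allP=> B sB; have /andP[_ sBK] := allP atom_in B sB.
  exact: subset_trans sBK sKG.
have <- : U *m avg_mx lG H *m avg_mx lG A = U *m avg_mx lG H.
  apply: mul_avg_mx_fixed => // x Ax.
  by have /setIdP[_ /eqP] := subsetP fixL x (subsetP sAL x Ax).
rewrite -mulmxA avg_mx_mul ?(joing_idPr sHA) //.
by apply: comm => //; apply/andP.
Qed.

End AtomComplement.

(** * Generating the regular representation *)

Section Generation.

Variables (F : fieldType) (gT : finGroupType) (G : {group gT}).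
Variables (m : nat) (V : 'I_m -> representation F G).

Definition coefficient (f : gT -> F) : Prop :=
  exists W : representation F G, generated V W /\
    exists (u : 'rV_(rdegree W)) (v : 'cV_(rdegree W)),
      {in G, forall x, f x = \tr (u *m W x *m v)}.

Lemma coefficientZ a f : coefficient f -> coefficient (fun x => a * f x).
Proof.
case=> W [genW [u [v fE]]]; exists W; split=> //; exists (a *: u), v => x Gx.
by rewrite fE // -!scalemxAl mxtraceZ.
Qed.

Lemma coefficientD f1 f2 :
  coefficient f1 -> coefficient f2 -> coefficient (fun x => f1 x + f2 x).
Proof.
case=> W1 [gen1 [u1 [v1 f1E]]] [W2 [gen2 [u2 [v2 f2E]]]].
exists (dadd_grepr W1 W2); split; first exact: Generated_sum.
exists (row_mx u1 u2), (col_mx v1 v2) => x Gx.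
rewrite /= mul_row_block !mulmx0 addr0 add0r mul_row_col raddfD /=.
by rewrite f1E // f2E.
Qed.

Lemma coefficientM f1 f2 :
  coefficient f1 -> coefficient f2 -> coefficient (fun x => f1 x * f2 x).
Proof.
case=> W1 [gen1 [u1 [v1 f1E]]] [W2 [gen2 [u2 [v2 f2E]]]].
exists (tensor_grepr W1 W2); split; first exact: Generated_tensor.
exists (tprod u1 u2), (tprod v1 v2) => x Gx.
rewrite f1E // f2E // -mxtrace_prod !tprodE; reflexivity.
Qed.

Lemma entry_coefficient i a b : coefficient (fun x => V i x a b).
Proof.
exists (V i); split; first exact: Generated_base.
exists (delta_mx 0 a), (delta_mx b 0) => x _.
by rewrite -rowE -colE trace_mx11 !mxE.
Qed.

(** Write the indicator function of 1 as x |-> u W(x) v. A linear relation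
    between the translates u W(x), multiplied on the right by W(y)^-1 v, shows
    that its coefficient at y vanishes; so u spans a copy of the regular
    representation, which splits off by complete reducibility. *)
Lemma coefficient_delta_generates :
    [pchar F]^'.-group G -> coefficient (fun x => (x == 1%g)%:R) ->
  generates_left_regular V.
Proof.
move=> charG [W [genW [u [v delta]]]]; exists W => //.
pose T := \matrix_(i < #|G|) (u *m W (enum_val i)).
have freeT : row_free T.
  (* The (x, y) entry of the product is the coefficient function at x y^-1. *)
  apply/row_freeP; exists (\matrix_(i, j) (W (enum_val j)^-1%g *m v) i 0).
  apply/matrixP=> i j; rewrite !mxE.
  have [Gi Gj] := (enum_valP i, enum_valP j).
  have -> : (i == j)%:R = (enum_val i * (enum_val j)^-1 == 1)%g%:R :> F.
    by rewrite -eq_mulgV1 (inj_eq enum_val_inj).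
  rewrite delta ?groupM ?groupV // repr_mxM ?groupV //.
  rewrite trace_mx11 -!mulmxA mulmxA mxE; apply: eq_bigr => k _.
  by rewrite !mxE.
have homT x : x \in G -> regular_repr F G x *m T = T *m W x.
  move=> Gx; apply/row_matrixP=> i; rewrite !row_mul rowK -rowE !rowK.
  by rewrite gring_indexK ?groupM ?enum_valP // repr_mxM ?enum_valP // mulmxA.
have modT : mxmodule W <<T>>%MS.
  apply/mxmoduleP=> x Gx; rewrite !genmxE (eqmxMr _ (genmxE T)) -homT //.
  exact: submxMl.
have [U' modU' defW dxW] := mx_Maschke_pchar W charG modT (submx1 _).
exists (Representation (submod_repr modU')).
have rsimT : mx_rsim (submod_repr modT) (left_regular_grepr F G).
  apply: mx_rsim_sym; apply: mx_rsim_trans (left_regular_rsim F G) _.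
  exists (in_submod <<T>>%MS T) => [||x Gx].
  - by rewrite genmxE (eqP freeT).
  - by rewrite /row_free mxrank_in_submod ?genmxE.
  by rewrite -in_submodJ ?genmxE // -homT // in_submodE mulmxA -in_submodE.
apply: mx_rsim_trans (mx_rsim_sym (rsim_submod1 (mxmodule1 W) (eqmx_refl _))) _.
pose rU' := Representation (submod_repr modU').
exact: (@mx_rsim_dadd _ _ _ _ _ _ _ _ _ rU' modT modU' _ defW dxW rsimT
  (mx_rsim_refl _)).
Qed.

(** Being 1 at the identity and 0 at finitely many other elements is reached by
    interpolation, starting from a coefficient function equal to 1 at the
    identity: a diagonal entry, as irreducible representations are nonzero, or
    a trivial one for the empty family. *)
Theorem faithful_family_generates :
    [pchar F]^'.-group G -> (forall i, mx_irreducible (V i)) ->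
    {in G, forall x, (forall i, x \in rker (V i)) -> x = 1%g} ->
  generates_left_regular V.
Proof.
move=> charG irrV faithV; apply: coefficient_delta_generates => //.
have sep y : y \in G -> y != 1%g ->
    exists2 f, coefficient f & f y != f 1%g.
  move=> Gy nty; apply: contrapT => nof; case/eqP: nty; apply: faithV => // i.
  apply/rkerP; split=> //; apply/matrixP=> a b; apply/eqP/idPn => neq.
  case: nof; exists (fun x => V i x a b); first exact: entry_coefficient.
  by rewrite repr_mx1.
have unit1 : exists2 f, coefficient f & f 1%g = 1.
  case: (posnP m) => [m0 | m_gt0].
    exists (fun x =>
      \tr ((1%:M : 'M[F]_1) *m triv_grepr F G x *m (1%:M : 'M_1))).
      exists (triv_grepr F G); split; first exact: Generated_empty.
      by exists 1%:M, 1%:M.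
    by rewrite !mulmx1 mxtrace1.
  have [_ nz1 _] := irrV (Ordinal m_gt0).
  have [a _|no_row] := pickP (fun _ : 'I_(rdegree (V (Ordinal m_gt0))) => true).
    exists (fun x => V (Ordinal m_gt0) x a a); first exact: entry_coefficient.
    by rewrite repr_mx1 mxE eqxx.
  by case/eqP: nz1; apply/matrixP=> a; have := no_row a.
have vanish (s : seq gT) : {subset s <= G^#} ->
    exists2 f, coefficient f & f 1%g = 1 /\ {in s, forall y, f y = 0}.
  elim: s => [|y s IHs] sG.
    by have [f cf f1] := unit1; exists f.
  have /setD1P[nty Gy] := sG y (mem_head _ _).
  have [|f cf [f1 fs]] := IHs; first by move=> z sz; rewrite sG // inE sz orbT.
  have [h ch hy] := sep y Gy nty.
  (* One step of Lagrange interpolation, written without a constant term: *)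
  (* constants need not be coefficient functions.                          *)
  exists (fun x => (h 1%g - h y)^-1 * (h x * f x + (- h y) * f x)).
    by apply: coefficientZ; apply: coefficientD;
      [apply: coefficientM | apply: coefficientZ].
  have nz : h 1%g - h y != 0 by rewrite subr_eq0 eq_sym.
  split=> [|z]; first by rewrite f1 !mulr1 mulVf.
  rewrite inE -mulrDl => /predU1P[->|sz]; first by rewrite subrr mul0r mulr0.
  by rewrite fs // !mulr0.
have [|f [W [genW [u [v fE]]]] [f1 fs]] := vanish (enum G^#).
  by move=> x; rewrite mem_enum.
exists W; split=> //; exists u, v => x Gx; rewrite -fE //.
have [->|ntx] := eqVneq; first by rewrite f1.
by rewrite fs // mem_enum !inE ntx.
Qed.

End Generation.

(** * Cyclic chains *)

Lemma cyclic_chain_sub (gT : finGroupType) (H : {group gT}) s :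
  path (@cyclic_step gT) H s -> H \subset last H s.
Proof.
elim: s H => //= K s IHs H /andP[/andP[prHK _] /IHs].
exact/subset_trans/proper_sub.
Qed.

(** The representations are indexed by nat to spare casts in the induction. *)
Lemma cyclic_chain_irr (F : fieldType) (gT : finGroupType)
    (G H : {group gT}) s :
    [pchar F] =i pred0 -> path (@cyclic_step gT) H s -> last H s \subset G ->
  exists V : nat -> representation F G,
    (forall i, (i < size s)%N -> mx_irreducible (V i)) /\
    {in last H s, forall x,
      (forall i, (i < size s)%N -> x \in rker (V i)) -> x \in H}.
Proof.
move=> charF0; elim: s H => [|K s IHs] H /=.
  by move=> _ _; exists (fun _ => grepr0); split=> // x Hx.
case/andP=> /andP[_ cycHK] chain_s sG.
have sKG := subset_trans (cyclic_chain_sub chain_s) sG.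
have [V [irrV kerV]] := IHs K chain_s sG.
have [V0 [irrV0 kerV0]] := cyclic_inclusion_irr charF0 sKG cycHK.
exists (fun i => if i is j.+1 then V j else V0); split=> [[|i]|x Kx kerx] //.
  exact: irrV.
apply: (subsetP kerV0); rewrite inE (kerx 0%N) //=.
by apply: kerV => // i lt_is; apply: (kerx i.+1).
Qed.

Theorem corollary7p36 (R : realType) (gT : finGroupType) (G : {group gT}) :
  exists V : 'I_(cyclic_length G) -> representation R[i] G,
    (forall i, mx_irreducible (V i)) /\ generates_left_regular V.
Proof.
rewrite /cyclic_length; case: ex_minnP.
move=> n /existsP[s /andP[chain /eqP defG]] _.
have charC0 : [pchar R[i]] =i pred0 by apply: Num.Theory.pchar_num.
have [|V [irrV kerV]] := @cyclic_chain_irr _ _ G _ _ charC0 chain.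
  by rewrite defG.
rewrite defG size_tuple in irrV kerV.
exists (fun i => V i); split=> [i|]; first exact: irrV.
apply: faithful_family_generates => [|i|x Gx kerx].
- exact: pchar0_pgroup.
- exact: irrV.
by apply/set1gP/kerV=> // i lt_in; apply: (kerx (Ordinal lt_in)).
Qed.
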